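(* Let $f$ be a smooth height function, and at a point of its domain let $\mathbf{J}=\mathbf{U}\boldsymbol{\Sigma}\mathbf{V}^T$ be the reduced singular value decomposition of the Jacobian of $\mathbf{p}(u,v)=[u,v,f(u,v)]^T$ given by $$\mathbf{U}=\begin{bmatrix}c/\ell&-s\\ s/\ell&c\\ \|\nabla f\|/\ell&0\end{bmatrix},\quad \boldsymbol{\Sigma}=\begin{bmatrix}\ell&0\\ 0&1\end{bmatrix},\quad \mathbf{V}=\begin{bmatrix}c&-s\\ s&c\end{bmatrix},$$ where $\ell=\sqrt{1+f_u^2+f_v^2}$, $c=f_u/\|\nabla f\|$ and $s=f_v/\|\nabla f\|$ (with $c=1$, $s=0$ if $f_u=f_v=0$). Let $\mathbf{u}_1,\mathbf{u}_2$ be the column vectors of $\mathbf{U}$ and let $\mathbf{S}=\boldsymbol{\Sigma}\mathbf{V}^T$. Then the matrix of the shape operator in the orthonormal basis $\{\mathbf{u}_1,\mathbf{u}_2\}$ is the symmetric matrix $$\tilde{\mathbf{W}}=\mathbf{S}^{-T}\mathbf{B}\mathbf{S}^{-1}=\frac1\ell\begin{bmatrix}c/\ell&s/\ell\\ -s&c\end{bmatrix}\mathbf{H}\begin{bmatrix}c/\ell&-s\\ s/\ell&c\end{bmatrix}.$$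
   Context: A height function is a smooth function $f$ from an open subset of $\mathbb{R}^2$ to $\mathbb{R}$; $\nabla f=[f_u,f_v]^T$ is its gradient and $\mathbf{H}$ its (symmetric) Hessian. Put $\mathbf{p}_u=[1,0,f_u]^T$, $\mathbf{p}_v=[0,1,f_v]^T$, $\mathbf{J}=[\mathbf{p}_u\mid\mathbf{p}_v]$; the column space of $\mathbf{J}$ is the tangent plane. The unit normal is $\hat{\mathbf{n}}=\frac1\ell[-f_u,-f_v,1]^T$, and the second fundamental matrix is $\mathbf{B}=\begin{bmatrix}\hat{\mathbf n}^T\mathbf p_{uu}&\hat{\mathbf n}^T\mathbf p_{uv}\\ \hat{\mathbf n}^T\mathbf p_{uv}&\hat{\mathbf n}^T\mathbf p_{vv}\end{bmatrix}=\mathbf{H}/\ell$. The shape operator is the linear map of the tangent plane sending $\mathbf{p}_u\mapsto-\hat{\mathbf{n}}_u$ and $\mathbf{p}_v\mapsto-\hat{\mathbf{n}}_v$; its matrix in the basis $\{\mathbf{p}_u,\mathbf{p}_v\}$ is the Weingarten matrix $\mathbf{W}=(\mathbf{J}^T\mathbf{J})^{-1}\mathbf{B}$. $\mathbf{S}^{-T}$ denotes $(\mathbf{S}^{-1})^T$. *)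

(* Defs.v *)
From HB Require Import structures.
From mathcomp Require Import all_boot all_order all_algebra.
From mathcomp Require Import all_classical all_reals all_analysis.
Import Order.TTheory GRing.Theory Num.Theory numFieldNormedType.Exports.

Set Implicit Arguments.
Unset Strict Implicit.
Unset Printing Implicit Defensive.

Local Open Scope classical_set_scope.
Local Open Scope ring_scope.

Definition mx_of_rows (R : realType) (m n : nat) (rows : seq (seq R)) : 'M[R]_(m, n) :=
  \matrix_(i < m, j < n) (nth [::] rows i)`_j.

(* The norm [`|w|] of the library on matrices is the sup norm. *)
Definition euclidean_norm (R : realType) (n : nat) (w : 'cV[R]_n) : R :=
  Num.sqrt (\sum_(i < n) w i 0 ^+ 2).

Section LinearAlgebra.
Variable R : realType.

(* Reduced SVD of a matrix of full column size: [D] is [n x n]. *)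
Definition is_reduced_svd (m n : nat)
    (A U : 'M[R]_(m, n)) (D V : 'M[R]_n) : Prop :=
  [/\ A = U *m D *m V^T,
      U^T *m U = 1%:M,
      V^T *m V = 1%:M,
      is_diag_mx D &
      (forall i, 0 <= D i i) /\ (forall i j : 'I_n, (i <= j)%N -> D j j <= D i i)].

Definition columns (m n : nat) (A : 'M[R]_(m, n)) : n.-tuple 'cV[R]_m :=
  [tuple col i A | i < n].

Definition is_orthonormal_basis (m n : nat)
    (T : {vspace 'cV[R]_m}) (e : n.-tuple 'cV[R]_m) : Prop :=
  basis_of T e /\
  forall i j : 'I_n, (tnth e i)^T *m tnth e j = ((i == j)%:R)%:M.

(* Column convention: column [j] lists the coordinates of [L e_j] in [e]
   (the library's [mxof] is the transpose of this). *)
Definition endo_matrix (m n : nat) (T : {vspace 'cV[R]_m})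
    (e : n.-tuple 'cV[R]_m) (L : 'End(subvs_of T)) : 'M[R]_n :=
  \matrix_(i < n, j < n) coord e i (vsval (L (vsproj T (tnth e j)))).

End LinearAlgebra.

Section HeightFunction.
Variable R : realType.

(* Points of the plane are column vectors; coordinate 0 is u, coordinate 1 is v. *)
Definition partial (V : normedModType R) (i : 'I_2) (g : 'cV[R]_2 -> V) :
    'cV[R]_2 -> V :=
  fun x => 'D_(delta_mx i 0) g x.

(* [smooth_on A f] only constrains [f] on [A] when [A] is open: every partial
   derivative of every order exists and is continuous at each point of [A]. *)
Definition smooth_on (A : set 'cV[R]_2) (f : 'cV[R]_2 -> R) : Prop :=
  forall (s : seq 'I_2) (x : 'cV[R]_2), A x ->
    {for x, continuous (foldr (@partial R) f s)} /\
    forall i : 'I_2, derivable (foldr (@partial R) f s) x (delta_mx i 0).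

Variable f : 'cV[R]_2 -> R.
Implicit Type x : 'cV[R]_2.

Definition f_u := partial 0 f.
Definition f_v := partial 1 f.

Definition gradient x : 'cV[R]_2 := \col_(i < 2) partial i f x.

Definition hessian x : 'M[R]_2 :=
  \matrix_(i < 2, j < 2) partial i (partial j f) x.

Definition graph_point x : 'cV[R]_3 :=
  mx_of_rows 3 1 [:: [:: x 0 0]; [:: x 1 0]; [:: f x]].

Definition p_u : 'cV[R]_2 -> 'cV[R]_3 := partial 0 graph_point.
Definition p_v : 'cV[R]_2 -> 'cV[R]_3 := partial 1 graph_point.

Definition jacobian_mx x : 'M[R]_(3, 2) := row_mx (p_u x) (p_v x).

Definition tangent_plane x : {vspace 'cV[R]_3} := <<columns (jacobian_mx x)>>%VS.

Definition ell x : R := Num.sqrt (1 + f_u x ^+ 2 + f_v x ^+ 2).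

Definition unit_normal x : 'cV[R]_3 :=
  (ell x)^-1 *: mx_of_rows 3 1 [:: [:: - f_u x]; [:: - f_v x]; [:: 1]].

Definition second_fundamental_mx x : 'M[R]_2 :=
  let n_dot (w : 'cV[R]_3) := ((unit_normal x)^T *m w) 0 0 in
  let p_uu := partial 0 p_u x in
  let p_uv := partial 1 p_u x in
  let p_vv := partial 1 p_v x in
  mx_of_rows 2 2 [:: [:: n_dot p_uu; n_dot p_uv];
                     [:: n_dot p_uv; n_dot p_vv]].

Definition is_shape_operator x (L : 'End(subvs_of (tangent_plane x))) : Prop :=
  vsval (L (vsproj (tangent_plane x) (p_u x))) = - partial 0 unit_normal x /\
  vsval (L (vsproj (tangent_plane x) (p_v x))) = - partial 1 unit_normal x.

Definition svd_c x : R :=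
  if gradient x == 0 then 1 else f_u x / euclidean_norm (gradient x).
Definition svd_s x : R :=
  if gradient x == 0 then 0 else f_v x / euclidean_norm (gradient x).

Definition svd_U x : 'M[R]_(3, 2) :=
  let c := svd_c x in let s := svd_s x in let l := ell x in
  mx_of_rows 3 2 [:: [:: c / l; - s];
                     [:: s / l; c];
                     [:: euclidean_norm (gradient x) / l; 0]].

Definition svd_Sigma x : 'M[R]_2 :=
  mx_of_rows 2 2 [:: [:: ell x; 0]; [:: 0; 1]].

Definition svd_V x : 'M[R]_2 :=
  mx_of_rows 2 2 [:: [:: svd_c x; - svd_s x]; [:: svd_s x; svd_c x]].

End HeightFunction.

(* Main.v *)
(** With S = Sigma V^T the decomposition reads J = U S.  Put N = -[n_u | n_v]:
    the shape operator sends the columns of U S to those of N, so as soon as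
    N = U W S its matrix in the orthonormal columns of U is W.  Differentiating
    the unit normal and using the symmetry of the Hessian gives N = U S^-T B,
    that is W = S^-T B S^-1.  The symmetry of the Hessian itself comes from
    the usual second-difference argument for mixed partial derivatives. *)
Require Import Defs.
From mathcomp Require Import all_boot all_order all_algebra.
From mathcomp Require Import all_classical all_reals all_analysis.
From mathcomp Require Import ring.
Import Order.TTheory GRing.Theory Num.Theory numFieldNormedType.Exports.

Set Implicit Arguments.
Unset Strict Implicit.
Unset Printing Implicit Defensive.

Local Open Scope classical_set_scope.
Local Open Scope ring_scope.

(** * Directional derivatives and the symmetry of mixed derivatives *)

Section DirectionalDerivatives.
Variables (R : realType) (V : normedModType R).

(** Both difference quotients are the same function of [h]. This brings directional derivatives
    within reach of the one-variable mean value theorem. *)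
Lemma is_derive_line (W : normedModType R) (f : V -> W) (v w : V) (s : R) :
  derivable f (s *: v + w) v ->
  is_derive s 1 (fun t : R => f (t *: v + w)) ('D_v f (s *: v + w)).
Proof.
have E : (fun h : R => h^-1 *: (f ((h *: 1 + s) *: v + w) - f (s *: v + w))) =
    (fun h => h^-1 *: (f (h *: v + (s *: v + w)) - f (s *: v + w))).
  by apply/funext => h; rewrite [h *: 1]mulr1 scalerDl addrA.
by move=> df; split; [rewrite /derivable|rewrite /derive] => /=; rewrite E.
Qed.

(** Restricting [f] to the line through [x] along [v] reduces this to the one-variable chain rule,
    so a single directional derivative of [f] suffices. *)
Lemma is_derive_comp1 (f : V -> R) (g : R -> R) (x v : V) (a b : R) :
  is_derive x v f a -> is_derive (f x) 1 g b ->
  is_derive x v (g \o f) (b * a).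
Proof.
have lineE (k : V -> R) : 'D_v k x = 'D_1 (fun t : R => k (t *: v + x)) 0.
  rewrite /derive; set k1 := (X in X @ _); set k2 := (X in _ = lim (X @ _)).
  suff -> : k1 = k2 by [].
  by apply/funext => h; rewrite /k1 /k2 /= addr0 scale0r add0r [h *: 1]mulr1.
move=> [df <-] dg; have {}df := (derivable1P _ _ _).1 df.
have dl : is_derive (0 : R) 1 (fun t : R => f (t *: v + x)) ('D_v f x).
  by split => //; rewrite lineE.
have [dgf gfE] : is_derive (0 : R) 1
    (g \o (fun t : R => f (t *: v + x))) (b * 'D_v f x).
  by apply: is_derive1_comp; rewrite scale0r add0r.
by split; [exact/derivable1P|rewrite lineE].
Qed.

(** The second difference is the increment over [[0, h]] of [phi], itself a difference in direction
    [e2]. The mean value theorem for [phi] yields [s]; applied again to ['D_e1 f] along [e2], it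
    yields [t]. *)
Lemma mixed_second_difference (f : V -> R) (x e1 e2 : V) (h k : R) :
  0 < h -> 0 < k ->
  (forall s t, 0 <= s <= h -> 0 <= t <= k ->
     derivable f (s *: e1 + (t *: e2 + x)) e1 /\
     derivable ('D_e1 f) (s *: e1 + (t *: e2 + x)) e2) ->
  exists s t, [/\ 0 <= s <= h, 0 <= t <= k &
    (f (h *: e1 + (k *: e2 + x)) - f (h *: e1 + x)) -
    (f (k *: e2 + x) - f x) =
    'D_e2 ('D_e1 f) (s *: e1 + (t *: e2 + x)) * k * h].
Proof.
move=> h0 k0 df.
have inI (b : R) z : z \in `[0, b] -> 0 <= z <= b by rewrite in_itv.
have kk : 0 <= k <= k by rewrite lexx ltW.
have k00 : 0 <= (0 : R) <= k by rewrite lexx ltW.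
pose phi (s : R) := f (s *: e1 + (k *: e2 + x)) - f (s *: e1 + x).
pose dphi (s : R) := 'D_e1 f (s *: e1 + (k *: e2 + x)) - 'D_e1 f (s *: e1 + x).
have phi_derive (s : R) : 0 <= s <= h -> is_derive s 1 phi (dphi s).
  move=> sh; apply: is_deriveB; apply: is_derive_line.
    exact: (df s k sh kk).1.
  by have := (df s 0 sh k00).1; rewrite scale0r add0r.
have [||s sh] := @MVT_segment R phi dphi 0 h (ltW h0).
- move=> s sh; apply: phi_derive.
  by move: sh; rewrite in_itv /= => /andP[? ?]; rewrite !ltW.
- by apply: derivable_within_continuous => s /inI sh; have [] := phi_derive s sh.
rewrite /phi scale0r !add0r subr0 => phiE.
have psi_derive (t : R) : 0 <= t <= k ->
    is_derive t 1 (fun t : R => 'D_e1 f (t *: e2 + (s *: e1 + x)))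
      ('D_e2 ('D_e1 f) (t *: e2 + (s *: e1 + x))).
  move=> tk; apply: is_derive_line.
  by rewrite addrCA; have [] := df s t (inI _ _ sh) tk.
have [||t tk] := @MVT_segment R (fun t : R => 'D_e1 f (t *: e2 + (s *: e1 + x)))
    (fun t : R => 'D_e2 ('D_e1 f) (t *: e2 + (s *: e1 + x))) 0 k (ltW k0).
- move=> t tk; apply: psi_derive.
  by move: tk; rewrite in_itv /= => /andP[? ?]; rewrite !ltW.
- by apply: derivable_within_continuous => t /inI tk; have [] := psi_derive t tk.
rewrite scale0r add0r subr0 => psiE.
exists s, t; split; [exact: inI|exact: inI|].
by rewrite phiE /dphi [s *: e1 + (k *: e2 + x)]addrCA psiE addrCA.
Qed.

(** The second difference on a small parallelogram is symmetric in [e1] and [e2], so the two mixed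
    derivatives agree at two points close to [x]; continuity carries this to [x] up to any
    [e > 0]. *)
Lemma derive_comm (f : V -> R) (x e1 e2 : V) :
  (\forall y \near x, derivable f y e1 /\ derivable ('D_e1 f) y e2) ->
  (\forall y \near x, derivable f y e2 /\ derivable ('D_e2 f) y e1) ->
  {for x, continuous ('D_e2 ('D_e1 f))} ->
  {for x, continuous ('D_e1 ('D_e2 f))} ->
  'D_e2 ('D_e1 f) x = 'D_e1 ('D_e2 f) x.
Proof.
move=> d12 d21 c12 c21.
apply/eqP; rewrite -subr_eq0 -normr_le0; apply/ler_addgt0Pr => e e0; rewrite add0r.
have dist_le (a b c d : R) :
    c = d -> `|a - c| < e / 2 -> `|b - d| < e / 2 -> `|a - b| <= e.
  move=> -> ad bd; rewrite (le_trans (ler_distD d _ _))// (splitr e).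
  by rewrite lerD ?ltW// distrC.
have e2_gt0 : 0 < e / 2 by rewrite divr_gt0.
have /nbhs_normP[r /= r0 rx] : \forall y \near x,
  [/\ derivable f y e1 /\ derivable ('D_e1 f) y e2,
      derivable f y e2 /\ derivable ('D_e2 f) y e1,
      `|'D_e2 ('D_e1 f) x - 'D_e2 ('D_e1 f) y| < e / 2 &
      `|'D_e1 ('D_e2 f) x - 'D_e1 ('D_e2 f) y| < e / 2].
  have n12 : \forall y \near x, `|'D_e2 ('D_e1 f) x - 'D_e2 ('D_e1 f) y| < e / 2.
    by move/cvgrPdist_lt: c12; apply.
  have n21 : \forall y \near x, `|'D_e1 ('D_e2 f) x - 'D_e1 ('D_e2 f) y| < e / 2.
    by move/cvgrPdist_lt: c21; apply.
  apply: filterS (filterI (filterI d12 d21) (filterI n12 n21)).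
  by move=> y [[? ?] [? ?]].
(* With this [h] the whole parallelogram lies in the ball of radius [r]; the summand 1 keeps the
   denominator positive even if [e1] and [e2] vanish. *)
pose h := r / (1 + `|e1| + `|e2|).
have n0 : 0 < 1 + `|e1| + `|e2| by rewrite -addrA ltr_pwDl.
have h0 : 0 < h by rewrite divr_gt0.
have mulhhI (a b c : R) : c = a * h * h -> c = b * h * h -> a = b.
  have hn0 : h != 0 by rewrite gt_eqF.
  by move=> -> ab; do 2 apply: (mulIf hn0).
have small s t : 0 <= s <= h -> 0 <= t <= h -> `|x - (s *: e1 + (t *: e2 + x))| < r.
  move=> /andP[s0 sh] /andP[t0 th].
  rewrite addrA opprD addrCA subrr addr0 normrN.
  rewrite (le_lt_trans (ler_normD _ _))// !normrZ !ger0_norm//.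
  rewrite (@le_lt_trans _ _ (h * `|e1| + h * `|e2|))//.
    by rewrite lerD// ler_wpM2r.
  rewrite -mulrDr /h mulrAC ltr_pdivrMr// ltr_pM2l//.
  by rewrite -addrA ltrDr.
have [|s [t [sh th E1]]] := @mixed_second_difference f x e1 e2 h h h0 h0.
  by move=> s t sh th; have [] := rx _ (small s t sh th).
have [|t' [s' [th' sh' E2]]] := @mixed_second_difference f x e2 e1 h h h0 h0.
  move=> t' s' th' sh'; rewrite addrCA.
  by have [] := rx _ (small s' t' sh' th').
have [_ _ A1 _] := rx _ (small s t sh th).
have [_ _ _] : _ := rx _ (small s' t' sh' th').
rewrite addrCA => A2.
(* Both second differences are the same four-term sum; equal sides [h] allow cancelling [h * h]. *)
have E : 'D_e2 ('D_e1 f) (s *: e1 + (t *: e2 + x)) =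
         'D_e1 ('D_e2 f) (t' *: e2 + (s' *: e1 + x)).
  apply: (mulhhI _ _ _ E1 (etrans _ E2)).
  by rewrite (addrCA (h *: e1)); ring.
exact: (dist_le _ _ _ _ E A1 A2).
Qed.

Lemma is_derive_mx (m n : nat) (M : V -> 'M[R]_(m.+1, n.+1))
    (D : 'M[R]_(m.+1, n.+1)) (x v : V) :
  (forall i j, is_derive x v (fun y => M y i j) (D i j)) -> is_derive x v M D.
Proof.
move=> dM.
have dMx : derivable M x v by apply/derivable_mxP => i j; have [] := dM i j.
split => //; rewrite derive_mx//.
by apply/matrixP => i j; rewrite mxE; have [_ ->] := dM i j.
Qed.

End DirectionalDerivatives.

Lemma is_derive_coord (R : realType) (m n : nat) (x v : 'M[R]_(m.+1, n.+1)) i j :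
  is_derive x v (fun y : 'M[R]_(m.+1, n.+1) => y i j) (v i j).
Proof.
have dx := @derivable_id _ _ x v.
have /derivable_mxP/(_ i j) dij := dx.
split => //.
by have := derive_mx dx; rewrite derive_id => /matrixP/(_ i j); rewrite mxE.
Qed.

(** Case analysis leaving the numerals [0] and [1], in which the partial derivatives are written,
    instead of raw ordinals. *)
Lemma ord2_ind (P : 'I_2 -> Prop) : P 0 -> P 1 -> forall i, P i.
Proof.
by move=> P0 P1 [[|[|//]] ilt]; [move: P0|move: P1]; congr P; apply/val_inj.
Qed.

(** * Derivatives of the height function, its graph and its unit normal *)

Section HeightFunctionDerivatives.
Variables (R : realType) (A : set 'cV[R]_2) (f : 'cV[R]_2 -> R).
Hypotheses (openA : open A) (smooth_f : smooth_on A f).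

Local Notation e_ k := (delta_mx k 0 : 'cV[R]_2).
Local Notation l_ := (ell f).

Lemma near_domain (x : 'cV[R]_2) : A x -> \forall y \near x, A y.
Proof. by move=> Ax; apply: open_nbhs_nbhs. Qed.

Lemma is_derive_partial (x : 'cV[R]_2) (i : 'I_2) :
  A x -> is_derive x (e_ i) f (partial i f x).
Proof. by move=> /(@smooth_f [::] x)[_ /(_ i)]. Qed.

Lemma is_derive_partial2 (x : 'cV[R]_2) (i j : 'I_2) :
  A x -> is_derive x (e_ i) (partial j f) (hessian f x i j).
Proof. by move=> /(@smooth_f [:: j] x)[_ /(_ i) df]; rewrite mxE; split. Qed.

(** Openness of [A] gives derivability near [x], and the two-letter words in [smooth_on] give
    continuity of both mixed partials. *)
Lemma hessian_sym (x : 'cV[R]_2) (i j : 'I_2) :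
  A x -> hessian f x i j = hessian f x j i.
Proof.
move=> Ax; rewrite !mxE; apply: derive_comm.
- apply: filterS (near_domain Ax) => y Ay.
  exact: (conj (@ex_derive _ _ _ _ _ _ _ (is_derive_partial j Ay))
    (@ex_derive _ _ _ _ _ _ _ (is_derive_partial2 i j Ay))).
- apply: filterS (near_domain Ax) => y Ay.
  exact: (conj (@ex_derive _ _ _ _ _ _ _ (is_derive_partial i Ay))
    (@ex_derive _ _ _ _ _ _ _ (is_derive_partial2 j i Ay))).
- exact: (smooth_f [:: i; j] Ax).1.
- exact: (smooth_f [:: j; i] Ax).1.
Qed.

Lemma is_derive_graph_point (x : 'cV[R]_2) (k : 'I_2) : A x ->
  is_derive x (e_ k) (graph_point f)
    (mx_of_rows 3 1 [:: [:: (k == 0)%:R]; [:: (k == 1)%:R]; [:: partial k f x]]).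
Proof.
move=> Ax; apply: is_derive_mx => i j; rewrite ord1 mxE.
case: i => [[|[|[|//]]] ilt] /=; under eq_fun do rewrite mxE /=.
- have := is_derive_coord x (e_ k) 0 0.
  by rewrite mxE eqxx andbT eq_sym.
- have := is_derive_coord x (e_ k) 1 0.
  by rewrite mxE eqxx andbT eq_sym.
- exact: is_derive_partial.
Qed.

Lemma partial_graph_point (x : 'cV[R]_2) (k : 'I_2) : A x ->
  partial k (graph_point f) x =
  mx_of_rows 3 1 [:: [:: (k == 0)%:R]; [:: (k == 1)%:R]; [:: partial k f x]].
Proof. by move=> /(is_derive_graph_point k)[_]. Qed.

Lemma partial2_graph_point (x : 'cV[R]_2) (i j : 'I_2) : A x ->
  partial i (partial j (graph_point f)) x =
  mx_of_rows 3 1 [:: [:: 0]; [:: 0]; [:: hessian f x i j]].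
Proof.
move=> Ax.
suff [] : is_derive x (e_ i) (partial j (graph_point f))
    (mx_of_rows 3 1 [:: [:: 0]; [:: 0]; [:: hessian f x i j]]) by [].
(* The formula for the first partial is known on [A] only, a neighbourhood of [x], which is enough
   to differentiate it at [x]. *)
apply: near_eq_is_derive; first apply: filterS (near_domain Ax) => y Ay.
  exact/esym/partial_graph_point.
apply: is_derive_mx => k m; rewrite ord1 mxE.
case: k => [[|[|[|//]]] klt] /=; under eq_fun do rewrite mxE /=.
- exact: is_derive_cst.
- exact: is_derive_cst.
- exact: is_derive_partial2.
Qed.

Lemma jacobian_mxE (x : 'cV[R]_2) : A x ->
  jacobian_mx f x =
  mx_of_rows 3 2 [:: [:: 1; 0]; [:: 0; 1]; [:: f_u f x; f_v f x]].
Proof.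
move=> Ax; rewrite /jacobian_mx /p_u /p_v !partial_graph_point//.
apply/matrixP => i j; rewrite !mxE.
case: splitP => m; rewrite ord1 => /= jE; rewrite mxE jE;
  by case: i => [[|[|[|//]]] ilt].
Qed.

Lemma ell_gt0 (x : 'cV[R]_2) : 0 < l_ x.
Proof. by rewrite sqrtr_gt0 -addrA ltr_pwDl// addr_ge0 ?sqr_ge0. Qed.

Lemma sqr_ell (x : 'cV[R]_2) : l_ x ^+ 2 = 1 + f_u f x ^+ 2 + f_v f x ^+ 2.
Proof. by rewrite sqr_sqrtr// !addr_ge0 ?sqr_ge0. Qed.

Lemma second_fundamental_mxE (x : 'cV[R]_2) : A x ->
  second_fundamental_mx f x = (l_ x)^-1 *: hessian f x.
Proof.
move=> Ax.
have nE i j : ((unit_normal f x)^T *m partial i (partial j (graph_point f)) x) 0 0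
    = (l_ x)^-1 * hessian f x i j.
  rewrite (partial2_graph_point i j Ax) mxE !big_ord_recl big_ord0 !mxE /=; ring.
(* [p_uv] produces the entry [1 0] of the Hessian, but fills both off-diagonal places. *)
have hsym := hessian_sym 1 0 Ax.
apply/matrixP; elim/ord2_ind; elim/ord2_ind; rewrite [LHS]mxE [RHS]mxE /=.
- exact: nE 0 0.
- by rewrite -hsym; exact: nE 1 0.
- exact: nE 1 0.
- exact: nE 1 1.
Qed.

(** Chain rule for the inverse square root composed with [q], the square of [ell]; positivity of
    [q x] makes the outer function derivable there. *)
Lemma is_derive_ellV (x : 'cV[R]_2) (k : 'I_2) : A x ->
  is_derive x (e_ k) (fun y => (l_ y)^-1)
    (- (f_u f x * hessian f x k 0 + f_v f x * hessian f x k 1) / l_ x ^+ 3).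
Proof.
move=> Ax; have l0 := ell_gt0 x.
have l2_gt0 : 0 < 1 + f_u f x ^+ 2 + f_v f x ^+ 2 by rewrite -sqr_ell exprn_gt0.
pose q y := 1 + f_u f y ^+ 2 + f_v f y ^+ 2.
have dq : is_derive x (e_ k) q
    (2 * (f_u f x * hessian f x k 0 + f_v f x * hessian f x k 1)).
  have du := is_derive_partial2 k 0 Ax; have dv := is_derive_partial2 k 1 Ax.
  apply: is_derive_eq (is_deriveD (is_deriveD (is_derive_cst (1 : R) x (e_ k))
    (is_deriveX 2 du)) (is_deriveX 2 dv)) _.
  rewrite /= add0r !expr1 /f_u /f_v /GRing.scale /=; ring.
have dV : is_derive (q x) 1 (fun t : R => (Num.sqrt t)^-1)
    (- (l_ x) ^- 2 *: (2 * l_ x)^-1).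
  by apply: is_deriveV; [rewrite gt_eqF|exact: is_derive1_sqrt].
apply: is_derive_eq (is_derive_comp1 dq dV) _.
by rewrite /GRing.scale /=; field; rewrite gt_eqF.
Qed.

(** Product rule, where [w] is the derivative of the factor [(ell f)^-1]. *)
Lemma partial_unit_normal (x : 'cV[R]_2) (k : 'I_2) : A x ->
  partial k (unit_normal f) x =
  let w := - (f_u f x * hessian f x k 0 + f_v f x * hessian f x k 1) / l_ x ^+ 3 in
  mx_of_rows 3 1 [:: [:: - (f_u f x * w + hessian f x k 0 / l_ x)];
                     [:: - (f_v f x * w + hessian f x k 1 / l_ x)]; [:: w]].
Proof.
move=> Ax /=; set w := _ / _.
have du := is_derive_partial2 k 0 Ax; have dv := is_derive_partial2 k 1 Ax.
have dl := is_derive_ellV k Ax.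
suff [] : is_derive x (e_ k) (unit_normal f)
  (mx_of_rows 3 1 [:: [:: - (f_u f x * w + hessian f x k 0 / l_ x)];
                     [:: - (f_v f x * w + hessian f x k 1 / l_ x)]; [:: w]]) by [].
apply: is_derive_mx => i j; rewrite ord1 mxE.
case: i => [[|[|[|//]]] ilt] /=; under eq_fun do rewrite !mxE /=.
- apply: is_derive_eq (is_deriveM dl (is_deriveN du)) _.
  by rewrite opprfctE /GRing.scale /= -/w /f_u; ring.
- apply: is_derive_eq (is_deriveM dl (is_deriveN dv)) _.
  by rewrite opprfctE /GRing.scale /= -/w /f_v; ring.
- by under eq_fun do rewrite mulr1.
Qed.

End HeightFunctionDerivatives.

(** * Column spaces and matrices of their endomorphisms *)

Section ColumnBases.
Variable R : realType.

Lemma tnth_columns (m n : nat) (A : 'M[R]_(m, n)) (j : 'I_n) :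
  tnth (columns A) j = col j A.
Proof. by rewrite tnth_mktuple. Qed.

Lemma col_mulmx_sum (m n p : nat) (A : 'M[R]_(m, n)) (M : 'M[R]_(n, p)) (j : 'I_p) :
  col j (A *m M) = \sum_k M k j *: col k A.
Proof.
apply/matrixP => i k; rewrite ord1 !mxE summxE.
by apply: eq_bigr => l _; rewrite !mxE mulrC.
Qed.

Lemma mem_span_columns (m n : nat) (A : 'M[R]_(m, n)) (j : 'I_n) :
  col j A \in <<columns A>>%VS.
Proof. by rewrite -tnth_columns memv_span// mem_tnth. Qed.

Lemma mem_span_columns_mulmx (m n p : nat) (A : 'M[R]_(m, n)) (M : 'M[R]_(n, p))
    (j : 'I_p) : col j (A *m M) \in <<columns A>>%VS.
Proof.
by rewrite col_mulmx_sum memv_suml// => k _; rewrite memvZ// mem_span_columns.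
Qed.

Lemma span_columns_mulmx (m n p : nat) (A : 'M[R]_(m, n)) (M : 'M[R]_(n, p)) :
  (<<columns (A *m M)>> <= <<columns A>>)%VS.
Proof.
apply/span_subvP => v /tnthP[j ->].
by rewrite tnth_columns mem_span_columns_mulmx.
Qed.

Lemma span_columns_unit (m n : nat) (A : 'M[R]_(m, n)) (S : 'M[R]_n) :
  S \in unitmx -> <<columns (A *m S)>>%VS = <<columns A>>%VS.
Proof.
move=> uS; apply/eqP; rewrite eqEsubv span_columns_mulmx /=.
(* The reverse inclusion comes from [A] being [A *m S] times [invmx S]. *)
by rewrite -{1}(mulmxK uS A) span_columns_mulmx.
Qed.

(** A vanishing combination reads [U *m K = 0], and multiplying by [U^T] returns [K = 0]. *)
Lemma free_columns (m n : nat) (U : 'M[R]_(m, n)) :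
  U^T *m U = 1%:M -> free (columns U).
Proof.
move=> UU; apply/freeP => k kU i.
pose K : 'cV[R]_n := \col_i k i.
have UK : U *m K = 0.
  apply/matrixP => a b; rewrite ord1; have /matrixP/(_ a 0) := kU.
  rewrite summxE mxE => <-; rewrite mxE; apply: eq_bigr => j _.
  by rewrite -tnth_nth tnth_columns !mxE mulrC.
have : U^T *m (U *m K) = 0 by rewrite UK mulmx0.
by rewrite mulmxA UU mul1mx => /matrixP/(_ i 0); rewrite !mxE.
Qed.

Lemma orthonormal_columns (m n : nat) (U : 'M[R]_(m, n)) (T : {vspace 'cV[R]_m}) :
  U^T *m U = 1%:M -> T = <<columns U>>%VS -> is_orthonormal_basis T (columns U).
Proof.
move=> UU ->; split; first by rewrite /basis_of eqxx free_columns.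
move=> i j; rewrite !tnth_columns; have /matrixP/(_ i j) := UU.
rewrite [RHS]mxE => <-; apply/matrixP => a b.
by rewrite !ord1 !mxE mulr1n; apply: eq_bigr => k _; rewrite !mxE.
Qed.

Section EndomorphismMatrix.
Variables (m n : nat) (U N : 'M[R]_(m, n)) (W S : 'M[R]_n).
Variable T : {vspace 'cV[R]_m}.
Hypotheses (UU : U^T *m U = 1%:M) (uS : S \in unitmx).
Hypotheses (TE : T = <<columns (U *m S)>>%VS) (NE : N = U *m W *m S).

(** The ambient map [U *m W *m U^T] sends [U *m S] to [N] because [U^T *m U = 1%:M]. The columns of
    [N] lie in [T], so projecting back onto [T] leaves them unchanged. *)
Lemma endo_of_columns : exists L : 'End(subvs_of T),
  forall k, vsval (L (vsproj T (col k (U *m S)))) = col k N.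
Proof.
exists (linfun (vsproj T) \o linfun (mulmx (U *m W *m U^T))
         \o linfun (@vsval _ _ T))%VF => k.
have memT : col k (U *m S) \in T by rewrite TE mem_span_columns.
have memN : col k N \in T.
  by rewrite TE span_columns_unit// NE -mulmxA mem_span_columns_mulmx.
rewrite !comp_lfunE !lfunE /= (vsprojK memT).
have -> : U *m W *m U^T *m col k (U *m S) = col k N.
  rewrite !colE !mulmxA NE; congr (_ *m _ *m _).
  by rewrite -[in LHS]mulmxA UU mulmx1.
exact: vsprojK memN.
Qed.

(** Since [U] is [U *m S] times [invmx S], linearity sends its columns to those of [N *m invmx S],
    that is [U *m W]; freeness of the columns of [U] then reads off [W]. *)
Lemma endo_matrix_columns (L : 'End(subvs_of T)) :
  (forall k, vsval (L (vsproj T (col k (U *m S)))) = col k N) ->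
  endo_matrix (columns U) L = W.
Proof.
move=> LE; apply/matrixP => i j; rewrite mxE tnth_columns.
have -> : vsval (L (vsproj T (col j U))) = \sum_k W k j *: (columns U)`_k.
  rewrite -[in LHS](mulmxK uS U) col_mulmx_sum !linear_sum /=.
  transitivity (col j (N *m invmx S)).
    by rewrite col_mulmx_sum; apply: eq_bigr => k _; rewrite !linearZ /= LE.
  rewrite NE mulmxK// col_mulmx_sum; apply: eq_bigr => k _.
  by rewrite -tnth_columns (tnth_nth 0).
by rewrite coord_sum_free// free_columns.
Qed.

End EndomorphismMatrix.
End ColumnBases.

(** Here and below, the numerals of ['I_2] are matched with the left and right injections into
    ['I_(1 + 1)] that index [row_mx]. *)
Lemma row_mx_cV0 (R : Type) (m : nat) (u v : 'cV[R]_m) (i : 'I_m) :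
  (row_mx u v : 'M[R]_(m, 2)) i 0 = u i 0.
Proof. by rewrite -(row_mxEl u v); congr (row_mx u v i _); apply/val_inj. Qed.

Lemma row_mx_cV1 (R : Type) (m : nat) (u v : 'cV[R]_m) (i : 'I_m) :
  (row_mx u v : 'M[R]_(m, 2)) i 1 = v i 0.
Proof. by rewrite -(row_mxEr u v); congr (row_mx u v i _); apply/val_inj. Qed.

(** * The explicit singular value decomposition and the Weingarten equations *)

Section SVD.
Variables (R : realType) (f : 'cV[R]_2 -> R) (x : 'cV[R]_2).

Local Notation c := (svd_c f x).
Local Notation s := (svd_s f x).
Local Notation g := (euclidean_norm (gradient f x)).
Local Notation l := (ell f x).

(** This is V Sigma^-1. It is also the upper block of [svd_U], as the upper block of the Jacobian is
    the identity. *)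
Definition svd_S_inv : 'M[R]_2 :=
  mx_of_rows 2 2 [:: [:: c / l; - s]; [:: s / l; c]].

Lemma sqr_norm_gradient : g ^+ 2 = f_u f x ^+ 2 + f_v f x ^+ 2.
Proof.
rewrite sqr_sqrtr ?sumr_ge0// => [|i _]; last exact: sqr_ge0.
rewrite big_ord_recl big_ord1 !mxE.
by rewrite (_ : ord0 = 0) 1?(_ : lift ord0 0 = 1)//; apply/val_inj.
Qed.

(** Polar form of the gradient. At a critical point [g = 0], and the defaults 1 and 0 still give a
    unit vector. The last equation has a single monomial on the left so that [field] and [ring] can
    rewrite with it. *)
Lemma polar_gradient : [/\ f_u f x = c * g, f_v f x = s * g & c ^+ 2 = 1 - s ^+ 2].
Proof.
have g2 := sqr_norm_gradient; rewrite /svd_c /svd_s.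
have [grad0|grad_neq0] := eqVneq (gradient f x) 0.
  have fE i : partial i f x = 0 by have /matrixP/(_ i 0) := grad0; rewrite !mxE.
  have g0 : g = 0 by apply/eqP; rewrite -sqrf_eq0 g2 /f_u /f_v !fE expr0n addr0.
  by rewrite g0 /f_u /f_v !fE !mulr0 expr1n expr0n subr0.
have g_neq0 : g != 0.
  apply: contra_neq grad_neq0 => g0.
  have [u0 v0] : f_u f x = 0 /\ f_v f x = 0.
    move: g2; rewrite g0; move: (f_u f x) (f_v f x) => p q /esym/eqP.
    by rewrite expr0n paddr_eq0 ?sqr_ge0// !sqrf_eq0 => /andP[/eqP-> /eqP->].
  by apply/matrixP; elim/ord2_ind => j; rewrite [LHS]mxE [RHS]mxE.
split; [exact/esym/divfK|exact/esym/divfK|].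
move: g2 g_neq0; move: (f_u f x) (f_v f x) g => p q r r2 r0.
have p2 : p ^+ 2 = r ^+ 2 - q ^+ 2 by rewrite r2 addrK.
by field: p2.
Qed.

Lemma sqr_ell_norm_gradient : l ^+ 2 = 1 + g ^+ 2.
Proof. by rewrite sqr_ell sqr_norm_gradient addrA. Qed.

Lemma svd_S_mul_inv : svd_Sigma f x *m (svd_V f x)^T *m svd_S_inv = 1%:M.
Proof.
have l0 : l != 0 by rewrite gt_eqF ?ell_gt0.
have [_ _ cs] := polar_gradient.
apply/matrixP; elim/ord2_ind; elim/ord2_ind;
  rewrite !(mxE, big_ord_recl, big_ord0) /=; field: cs; rewrite ?l0 //.
Qed.

(** The first column has squared norm [(c ^+ 2 + s ^+ 2 + g ^+ 2) / l ^+ 2], whose numerator is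
    [1 + g ^+ 2 = l ^+ 2]. *)
Lemma svd_U_orthonormal : (svd_U f x)^T *m svd_U f x = 1%:M.
Proof.
have l0 : l != 0 by rewrite gt_eqF ?ell_gt0.
have [_ _ cs] := polar_gradient; have l2 := sqr_ell_norm_gradient.
apply/matrixP; elim/ord2_ind; elim/ord2_ind;
  rewrite !(mxE, big_ord_recl, big_ord0) /=; field: cs l2; rewrite ?l0 //.
Qed.

Lemma svd_V_orthonormal : (svd_V f x)^T *m svd_V f x = 1%:M.
Proof.
have [_ _ cs] := polar_gradient.
apply/matrixP; elim/ord2_ind; elim/ord2_ind;
  rewrite !(mxE, big_ord_recl, big_ord0) /=; ring: cs.
Qed.

Lemma svd_jacobian : mx_of_rows 3 2 [:: [:: 1; 0]; [:: 0; 1]; [:: f_u f x; f_v f x]] =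
  svd_U f x *m svd_Sigma f x *m (svd_V f x)^T.
Proof.
have l0 : l != 0 by rewrite gt_eqF ?ell_gt0.
have [pE qE cs] := polar_gradient.
rewrite pE qE; apply/matrixP => -[[|[|[|//]]] ?]; elim/ord2_ind;
  rewrite !(mxE, big_ord_recl, big_ord0) /=; field: cs; rewrite ?l0 //.
Qed.

(** These are the equations N = J W with W = (J^T J)^-1 B: as J = U S and U^T U = 1, the right side
    is U S^-T B. They are checked entry by entry. *)
Lemma weingarten_equations (A : set 'cV[R]_2) :
  open A -> smooth_on A f -> A x ->
  row_mx (- partial 0 (unit_normal f) x) (- partial 1 (unit_normal f) x) =
  svd_U f x *m svd_S_inv^T *m (l^-1 *: hessian f x).
Proof.
move=> oA sf Ax.
have l0 : l != 0 by rewrite gt_eqF ?ell_gt0.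
have [pE qE cs] := polar_gradient; have l2 := sqr_ell_norm_gradient.
rewrite !(partial_unit_normal sf _ Ax) pE qE.
have := hessian_sym oA sf 0 1 Ax.
move: (hessian f x) => H H01.
(* Symmetry leaves three free scalars, so each entry becomes a rational identity modulo [cs] and
   [l2]. *)
have {H01} -> : H = mx_of_rows 2 2 [:: [:: H 0 0; H 0 1]; [:: H 0 1; H 1 1]].
  by apply/matrixP; elim/ord2_ind; elim/ord2_ind; rewrite mxE.
move: (H 0 0) (H 0 1) (H 1 1) => h00 h01 h11.
apply/matrixP => i; elim/ord2_ind; rewrite ?row_mx_cV0 ?row_mx_cV1;
  case: i => [[|[|[|//]]] ?]; rewrite !(mxE, big_ord_recl, big_ord0) /=;
  by field: cs l2; rewrite ?l0.
Qed.

Lemma svd_reduced (A : set 'cV[R]_2) : smooth_on A f -> A x ->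
  is_reduced_svd (jacobian_mx f x) (svd_U f x) (svd_Sigma f x) (svd_V f x).
Proof.
(* This bound puts the singular values [l] and 1 in decreasing order. *)
move=> sf Ax; have l1 : 1 <= l.
  by rewrite -[leLHS]sqrtr1 ler_wsqrtr// -addrA lerDl addr_ge0 ?sqr_ge0.
split.
- by rewrite (jacobian_mxE sf Ax) svd_jacobian.
- exact: svd_U_orthonormal.
- exact: svd_V_orthonormal.
- by apply/is_diag_mxP; elim/ord2_ind; elim/ord2_ind => // _; rewrite mxE.
- split; first by elim/ord2_ind; rewrite mxE //= ltW ?ell_gt0.
  by elim/ord2_ind; elim/ord2_ind => // _; rewrite !mxE.
Qed.
End SVD.

(** * The shape operator in the basis of left singular vectors *)

Theorem theorem1 (R : realType) (A : set 'cV[R]_2) (f : 'cV[R]_2 -> R)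
    (x : 'cV[R]_2) (openA : open A) (smooth_f : smooth_on A f) (Ax : A x) :
  let c := svd_c f x in
  let s := svd_s f x in
  let l := ell f x in
  let U := svd_U f x in
  let S := svd_Sigma f x *m (svd_V f x)^T in
  let B := second_fundamental_mx f x in
  let Wt := (invmx S)^T *m B *m invmx S in
  [/\ is_reduced_svd (jacobian_mx f x) U (svd_Sigma f x) (svd_V f x),
      S \in unitmx,
      is_orthonormal_basis (tangent_plane f x) (columns U),
      (exists L, is_shape_operator (f := f) (x := x) L) /\
      (forall L, is_shape_operator (f := f) (x := x) L ->
         endo_matrix (columns U) L = Wt) &
      Wt^T = Wt /\
      Wt = l^-1 *:
        (mx_of_rows 2 2 [:: [:: c / l; s / l]; [:: - s; c]] *m hessian f x *m
         mx_of_rows 2 2 [:: [:: c / l; - s]; [:: s / l; c]])].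
Proof.
move=> c s l U S B Wt.
have svd := svd_reduced smooth_f Ax.
have [JE UU _ _ _] := svd.
have SSi : S *m svd_S_inv f x = 1%:M := svd_S_mul_inv f x.
have [uS _] := mulmx1_unit SSi.
have SiE : invmx S = svd_S_inv f x by rewrite -[RHS](mulKmx uS) SSi mulmx1.
have BE : B = l^-1 *: hessian f x := second_fundamental_mxE openA smooth_f Ax.
have JUS : jacobian_mx f x = U *m S by rewrite JE -mulmxA.
have TE : tangent_plane f x = <<columns (U *m S)>>%VS.
  by rewrite /tangent_plane JUS.
(* Inserting [invmx S *m S] after [B] turns the Weingarten equations into the factorization through
   [Wt]. *)
have NE : row_mx (- partial 0 (unit_normal f) x) (- partial 1 (unit_normal f) x) =
    U *m Wt *m S.
  rewrite (weingarten_equations openA smooth_f Ax) /Wt -BE SiE.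
  by rewrite -!mulmxA -SiE mulVmx// mulmx1 !mulmxA.
have col2 (u v : 'cV[R]_3) : col 0 (row_mx u v) = u /\ col 1 (row_mx u v) = v.
  by split; apply/matrixP => i j; rewrite ord1 mxE ?row_mx_cV0 ?row_mx_cV1.
(* The two defining equations, read columnwise on [U *m S], take the form used for endomorphisms of
   a column space. *)
have shapeP L : is_shape_operator (f := f) (x := x) L <->
    forall k, vsval (L (vsproj (tangent_plane f x) (col k (U *m S)))) =
      col k (row_mx (- partial 0 (unit_normal f) x) (- partial 1 (unit_normal f) x)).
  have [J0 J1] := col2 (p_u f x) (p_v f x).
  have [N0 N1] := col2 (- partial 0 (unit_normal f) x) (- partial 1 (unit_normal f) x).
  split=> [[Lu Lv]|LE].
    by apply: ord2_ind; rewrite -JUS ?(J0, J1, N0, N1).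
  by split; [have := LE 0|have := LE 1]; rewrite -JUS ?(J0, J1, N0, N1).
split=> //.
- by apply: orthonormal_columns => //; rewrite TE span_columns_unit.
- split; first by have [L /shapeP] := endo_of_columns UU uS TE NE; exists L.
  by move=> L /shapeP; apply: endo_matrix_columns.
have HT : (hessian f x)^T = hessian f x.
  by apply/matrixP => i j; rewrite mxE (hessian_sym openA smooth_f).
(* [Wt] is congruent, through [invmx S], to a multiple of the symmetric Hessian. *)
split; first by rewrite /Wt BE !trmx_mul trmxK linearZ /= HT mulmxA.
rewrite /Wt BE SiE -scalemxAr -scalemxAl; congr (_ *: (_ *m _ *m _)).
by apply/matrixP; elim/ord2_ind; elim/ord2_ind; rewrite !mxE.
Qed.
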